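(* Let $X=\{1,2,3\}$, let $D: X\times X\to[0,+\infty)$ be defined by $D(1,1)=D(2,2)=D(3,3)=0$, $D(1,2)=D(2,1)=2$, $D(2,3)=D(3,2)=1$, $D(1,3)=D(3,1)=6$, and let $T: X\to X$ be defined by $T1=2$, $T2=3$, $T3=1$. Then: (1) $(X,D,K)$ is a complete strong $b$-metric space with $K=4$. (2) With $x_0=1$, $r=6$ and $k=\frac12$, the following hold, where each value $Tx$ is regarded as the singleton set $\{Tx\}$ and $B(x_0,r)=\{x\in X: D(x_0,x)<r\}$: $T$ maps $X$ into a non-empty closed subset of $X$; $\mathrm{dist}(x_0,Tx_0)<r(1-k)$; and $\delta(Tx\cap B(x_0,r),Ty)\le k\,D(x,y)$ for all $x,y\in B(x_0,r)$ with $Tx\cap B(x_0,r)\neq\emptyset$. (3) $T$ has no fixed point.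
   Context: A strong $b$-metric space is a triple $(X,D,K)$ where $X$ is a non-empty set, $K \ge 1$ is a real number, and $D: X\times X \to [0,+\infty)$ is a function such that for all $x,y,z \in X$: (i) $D(x,y)=0$ if and only if $x=y$; (ii) $D(x,y)=D(y,x)$; (iii) $D(x,z) \le D(x,y) + K D(y,z)$. A sequence $\{x_n\}$ converges to $x$ if $\lim_{n\to\infty} D(x_n,x)=0$; it is Cauchy if $\lim_{n,m\to\infty} D(x_n,x_m)=0$. The space is complete if every Cauchy sequence converges. The space carries the topology induced by this convergence. For $x\in X$ and non-empty $A,B\subset X$, $\mathrm{dist}(x,A)=\inf\{D(x,a): a\in A\}$ and $\delta(A,B)=\sup\{\mathrm{dist}(x,A): x\in B\}$. *)

(* Defs.v *)
From HB Require Import structures.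
From mathcomp Require Import all_boot all_order all_algebra.
From mathcomp Require Import all_classical all_reals all_analysis.

Set Implicit Arguments.
Unset Strict Implicit.
Unset Printing Implicit Defensive.

Import Order.TTheory GRing.Theory Num.Theory.
Import numFieldNormedType.Exports.

Local Open Scope classical_set_scope.
Local Open Scope ring_scope.

Record strong_b_metric (R : realType) (X : Type) (D : X -> X -> R) (K : R) :
    Prop := StrongBMetric {
  sbm_inhabited : inhabited X;
  sbm_K_ge1 : 1 <= K;
  sbm_ge0 : forall x y, 0 <= D x y;
  sbm_eq0 : forall x y, D x y = 0 <-> x = y;
  sbm_sym : forall x y, D x y = D y x;
  sbm_triangle : forall x y z, D x z <= D x y + K * D y z }.

Definition sbm_cvg (R : realType) (X : Type) (D : X -> X -> R)
    (u : nat -> X) (x : X) : Prop :=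
  D (u n) x @[n --> \oo] --> (0 : R).

Definition sbm_cauchy (R : realType) (X : Type) (D : X -> X -> R)
    (u : nat -> X) : Prop :=
  D (u p.1) (u p.2) @[p --> (\oo, \oo)] --> (0 : R).

Definition sbm_complete (R : realType) (X : Type) (D : X -> X -> R) : Prop :=
  forall u : nat -> X, sbm_cauchy D u -> exists x, sbm_cvg D u x.

(* The topology induced by the convergence: a set is open when every sequence
   converging to one of its points is eventually in it. *)
Definition sbm_open (R : realType) (X : Type) (D : X -> X -> R) (A : set X) :
    Prop :=
  forall (u : nat -> X) (x : X),
    A x -> sbm_cvg D u x -> \forall n \near \oo, A (u n).

Definition sbm_closed (R : realType) (X : Type) (D : X -> X -> R) (A : set X) :
    Prop :=
  sbm_open D (~` A).

Definition sbm_ball (R : realType) (X : Type) (D : X -> X -> R)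
    (x0 : X) (r : R) : set X :=
  [set x | D x0 x < r].

(* Meaningful for A non-empty and D >= 0; inf set0 is 0 by convention. *)
Definition sbm_dist (R : realType) (X : Type) (D : X -> X -> R)
    (x : X) (A : set X) : R :=
  inf [set D x a | a in A].

(* Extended-real valued: the supremum may be infinite when B is unbounded.
   The points range over the second argument, so delta is not symmetric. *)
Definition sbm_delta (R : realType) (X : Type) (D : X -> X -> R)
    (A B : set X) : \bar R :=
  ereal_sup [set (sbm_dist D x A)%:E | x in B].

Inductive X3 : Set := x1 | x2 | x3.

Definition D3 (R : realType) (x y : X3) : R :=
  match x, y with
  | x1, x1 | x2, x2 | x3, x3 => 0
  | x1, x2 | x2, x1 => 2
  | x2, x3 | x3, x2 => 1
  | x1, x3 | x3, x1 => 6
  end.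

Definition T3 (x : X3) : X3 :=
  match x with x1 => x2 | x2 => x3 | x3 => x1 end.

(* Main.v *)
Require Import Defs.
From HB Require Import structures.
From mathcomp Require Import all_boot all_order all_algebra.
From mathcomp Require Import all_classical all_reals all_analysis.
From mathcomp Require Import lra.

Import Order.TTheory GRing.Theory Num.Theory.
Import numFieldNormedType.Exports.

Local Open Scope classical_set_scope.
Local Open Scope ring_scope.

(** Distinct points are at distance at least 1, so convergent and Cauchy
    sequences are eventually constant: the space is complete and discrete.
    The ball of radius 6 around 1 is {1, 2}, and T2 = 3 lies outside it, so the
    contraction condition is tested only at x = 1, where it reads
    D(2, 2) <= D(1, 1) / 2 for y = 1 and D(2, 3) <= D(1, 2) / 2 for y = 2. *)

Lemma D3_xx (R : realType) (x : X3) : D3 R x x = 0.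
Proof. by case: x. Qed.

Lemma D3_lt1 (R : realType) (x y : X3) : D3 R x y < 1 -> x = y.
Proof. by case: x; case: y => //= h; exfalso; move: h; lra. Qed.

Lemma D3_strong_b_metric (R : realType) : strong_b_metric (D3 R) 4.
Proof.
split.
- exact: (inhabits x1).
- by lra.
- by case; case => /=; lra.
- move=> x y; split=> [h|->]; last exact: D3_xx.
  by apply: (@D3_lt1 R); rewrite h.
- by case; case.
(* The path 1, 2, 3 is the tight case: 6 = 2 + 4 * 1, so no constant below 4 would do. *)
- by case; case; case => /=; lra.
Qed.

Lemma D3_cvg_near_eq (R : realType) (u : nat -> X3) (x : X3) :
  sbm_cvg (D3 R) u x -> \forall n \near \oo, u n = x.
Proof.
move=> /cvgr_lt /(_ 1 ltr01); apply: filterS => n; exact: D3_lt1.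
Qed.

Lemma D3_complete (R : realType) : sbm_complete (D3 R).
Proof.
move=> u /cvgr_lt /(_ 1 ltr01) [[A B]] /= [[N _ NA] [M _ MB]] AB.
(* The limit is a term of the sequence: pairing each [n >= N] with the fixed index [M] keeps the
   distance below 1. *)
exists (u M); apply: cvg_near_cst; exists N => // n /= Nn.
have -> : u n = u M.
  by apply: (@D3_lt1 R); apply: (AB (n, M)); split; [exact: NA|apply: MB => /=].
exact: D3_xx.
Qed.

Lemma D3_closed (R : realType) (A : set X3) : sbm_closed (D3 R) A.
Proof.
by move=> u x Ax /D3_cvg_near_eq; apply: filterS => n ->.
Qed.

Lemma sbm_dist_set1 (R : realType) (X : Type) (D : X -> X -> R) (x a : X) :
  sbm_dist D x [set a] = D x a.
Proof. by rewrite /sbm_dist image_set1 inf1. Qed.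

Lemma sbm_delta_set1 (R : realType) (X : Type) (D : X -> X -> R)
    (A : set X) (b : X) :
  sbm_delta D A [set b] = (sbm_dist D b A)%:E.
Proof. by rewrite /sbm_delta image_set1 ereal_sup1. Qed.

Theorem mainTheorem2 (R : realType) :
  let D := @D3 R in
  let r : R := 6 in
  let k : R := 1 / 2 in
  let B := sbm_ball D x1 r in
  (strong_b_metric D 4 /\ sbm_complete D) /\
  ((forall x : X3, [set T3 x] !=set0 /\ sbm_closed D [set T3 x]) /\
   sbm_dist D x1 [set T3 x1] < r * (1 - k) /\
   (forall x y : X3, B x -> B y -> [set T3 x] `&` B !=set0 ->
      (sbm_delta D ([set T3 x] `&` B) [set T3 y] <= (k * D x y)%:E)%E)) /\
  ~ (exists x : X3, T3 x = x).
Proof.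
move=> D r k B; split.
  by split; [exact: D3_strong_b_metric | exact: D3_complete].
split; last by case; case.
split; first by move=> x; split; [exists (T3 x) | exact: D3_closed].
split; first by rewrite sbm_dist_set1 /D /r /k /=; lra.
(* The distance from 1 to 3 equals the radius, and the ball is open. *)
have B3 : ~ B x3 by rewrite /B /sbm_ball /= /D /r /= ltxx.
move=> x y Bx By [z [/= zE Bz]]; rewrite {}zE in Bz.
(* As [T3 x] lies in the ball, [sbm_delta] reduces to the single distance [D (T3 y) (T3 x)]. *)
have -> : [set T3 x] `&` B = [set T3 x] by apply/setIidPl => _ ->.
rewrite sbm_delta_set1 sbm_dist_set1 lee_fin /k /D.
(* [B3] refutes [Bx] at 3, [Bz] at 2 and [By] at 3; at [y = x2] the bound is an equality. *)
by case: x Bx Bz => //= _ _; case: y By => //= _; lra.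
Qed.
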